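(* Let $\Phi$ be a Leonard system over $\mathbb F$ of type IV (so $d=3$ and $\mathrm{Char}(\mathbb F)=2$), with eigenvalue sequence $\{\theta_i\}_{i=0}^3$, dual eigenvalue sequence $\{\theta^*_i\}_{i=0}^3$, and let $a,b,c,a^*,b^*,c^*\in\mathbb F$ be the unique scalars with $\theta_0=a$, $\theta_1=b+c$, $\theta_2=a+c$, $\theta_3=b$, $\theta^*_0=a^*$, $\theta^*_1=b^*+c^*$, $\theta^*_2=a^*+c^*$, $\theta^*_3=b^*$. Let $\{\varphi_i\}_{i=1}^3$, $\{\phi_i\}_{i=1}^3$ be the first and second split sequences of $\Phi$, and let $\psi\in\overline{\mathbb F}$ satisfy $$cc^*\varphi_1=(ac^*+a^*c+cc^*\psi)(bc^*+b^*c+cc^*+cc^*\psi),$$ $$cc^*\varphi_3=(bc^*+b^*c+cc^*\psi)(ac^*+a^*c+cc^*+cc^*\psi),$$ $$cc^*\phi_1=(bc^*+a^*c+cc^*\psi)(ac^*+b^*c+cc^*+cc^*\psi),$$ $$cc^*\phi_3=(ac^*+b^*c+cc^*\psi)(bc^*+a^*c+cc^*+cc^*\psi).$$ Let $\hat P$ be the normalized Drinfel'd polynomial of $\Phi$. Then the roots of $\hat P$ are $$ab^*+ba^*+(cc^*\psi+ac^*+b^*c)(cc^*\psi+a^*c+bc^* )c^{-1}c^{*-1},$$ $$ab^*+ba^*+(cc^*\psi+ac^*+b^*c+cc^* )(cc^*\psi+a^*c+bc^*+cc^* )c^{-1}c^{*-1}.$$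
   Context: Let $\mathbb F$ be a field, $\overline{\mathbb F}$ its algebraic closure, $V$ a vector space over $\mathbb F$ of finite positive dimension. A tridiagonal pair on $V$ is an ordered pair of $\mathbb F$-linear maps $A,A^*:V\to V$ ($A^*$ is just a name, not an adjoint) such that: (i) both are diagonalizable; (ii) the eigenspaces of $A$ can be ordered $V_0,\dots,V_d$ with $A^*V_i\subseteq V_{i-1}+V_i+V_{i+1}$ ($0\le i\le d$, $V_{-1}=V_{d+1}=0$); (iii) the eigenspaces of $A^*$ can be ordered $V^*_0,\dots,V^*_\delta$ with $AV^*_i\subseteq V^*_{i-1}+V^*_i+V^*_{i+1}$ ($0\le i\le\delta$, $V^*_{-1}=V^*_{\delta+1}=0$); (iv) no subspace $W\ne 0,V$ satisfies $AW\subseteq W$ and $A^*W\subseteq W$. It is known that $d=\delta$ (the diameter) and $\dim V_i=\dim V^*_i=\dim V_{d-i}$. Orderings as in (ii), (iii) are called standard. The pair is a Leonard pair if all $V_i$, $V_i^*$ have dimension 1. A tridiagonal system over $\mathbb F$ is a sequence $\Phi=(A;\{E_i\}_{i=0}^d;A^*;\{E^*_i\}_{i=0}^d)$ where $A,A^*$ is a tridiagonal pair and, for standard orderings of the eigenspaces, $E_i$ (resp. $E^*_i$) is the projection onto $V_i$ (resp. $V^*_i$) along the sum of the other eigenspaces. $\Phi$ is a Leonard system if $A,A^*$ is a Leonard pair. The eigenvalue sequence $\{\theta_i\}$ (dual eigenvalue sequence $\{\theta^*_i\}$) consists of the eigenvalues of $A$ on $E_iV$ (of $A^*$ on $E^*_iV$).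 For $\dim E^*_0V=1$, $E^*_0V$ is known to be invariant under $(A^*-\theta^*_1I)\cdots(A^*-\theta^*_iI)(A-\theta_{i-1}I)\cdots(A-\theta_0I)$ for $0\le i\le d$; $\zeta_i$ denotes the corresponding eigenvalue, and $\{\zeta_i\}_{i=0}^d$ is the split sequence of $\Phi$ ($\zeta_0=1$). Put $\Phi^\Downarrow=(A;\{E_{d-i}\}_{i=0}^d;A^*;\{E^*_i\}_{i=0}^d)$. For a Leonard system the split sequences of $\Phi$ and $\Phi^\Downarrow$ are known to have nonzero entries, and the first split sequence $\{\varphi_i\}_{i=1}^d$ (second split sequence $\{\phi_i\}_{i=1}^d$) is determined by the requirement that $\{\varphi_1\cdots\varphi_i\}_{i=0}^d$ (resp. $\{\phi_1\cdots\phi_i\}_{i=0}^d$) is the split sequence of $\Phi$ (resp. $\Phi^\Downarrow$). Base $\beta\in\mathbb F$: if $d\ge3$, the expressions $\frac{\theta_{i-2}-\theta_{i+1}}{\theta_{i-1}-\theta_i}$, $\frac{\theta^*_{i-2}-\theta^*_{i+1}}{\theta^*_{i-1}-\theta^*_i}$ are known to be equal and independent of $i$ for $2\le i\le d-1$, and $\beta+1$ is their common value; if $d\le2$, $\beta$ is any fixed nonzero scalar in $\mathbb F$. Type IV means $\beta=0$ and $\mathrm{Char}(\mathbb F)=2$; it is known that then $d=3$. The scalars $c,c^*$ are nonzero since the $\theta_i$ (and the $\theta_i^*$) are distinct. It is known (from the classification of Leonard systems) that for a type IV Leonard system there is $\varphi\in\mathbb F$ with $\varphi_1=\varphi$, $\varphi_2=cc^*$,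 $\varphi_3=\varphi+(a+b)c^*+c(a^*+b^* )$, $\phi_1=\varphi+(a+b)(a^*+b^*+c^* )$, $\phi_2=cc^*$, $\phi_3=\varphi+(a+b+c)(a^*+b^* )$. A scalar $\psi$ as in the claim exists. Normalized Drinfel'd polynomial (type IV): $\hat P=\hat p_1\hat p_2\hat p_3+\zeta_1\hat p_2\hat p_3+\zeta_2\hat p_3+\zeta_3\in\mathbb F[\lambda]$, where $\hat p_1=ab^*+ba^*+(a+b+c)(a^*+b^*+c^* )+\lambda$, $\hat p_2=cc^*$, $\hat p_3=ab^*+ba^*+(a+b)(a^*+b^* )+\lambda$. It has degree exactly 2. *)

(* Defs.v *)
From mathcomp Require Import all_boot all_order all_algebra.

Set Implicit Arguments.
Unset Strict Implicit.
Unset Printing Implicit Defensive.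

Import GRing.Theory.
Local Open Scope ring_scope.

Section TridiagonalPairs.

Variables (F : fieldType) (V : vectType F).
Implicit Types (A B : 'End(V)).

Definition lfun_diagonalizable A : Prop :=
  exists2 b : seq V,
    basis_of fullv b & forall v, v \in b -> exists x : F, A v = x *: v.

(* W_0, ..., W_d lists every eigenspace of A exactly once. *)
Definition eigenspace_ordering A (d : nat) (W : 'I_d.+1 -> {vspace V}) : Prop :=
  exists th : 'I_d.+1 -> F,
    [/\ injective th,
        forall x, passmx.leigenvalue A x <-> exists i, x = th i
      & forall i, W i = passmx.leigenspace A (th i)].

(* The sum over j with |i - j| <= 1 is W_{i-1} + W_i + W_{i+1}, with the
   convention W_{-1} = W_{d+1} = 0. *)
Definition standard_ordering A B (d : nat) (W : 'I_d.+1 -> {vspace V}) : Prop :=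
  eigenspace_ordering A W /\
  forall i : 'I_d.+1,
    (B @: W i <= \sum_(j < d.+1 | (j <= i.+1)%N && (i <= j.+1)%N) W j)%VS.

Definition tridiagonal_pair A B : Prop :=
  [/\ lfun_diagonalizable A /\ lfun_diagonalizable B,
      exists (d : nat) (W : 'I_d.+1 -> {vspace V}), standard_ordering A B W,
      exists (e : nat) (W : 'I_e.+1 -> {vspace V}), standard_ordering B A W
    & forall W : {vspace V},
        (A @: W <= W)%VS -> (B @: W <= W)%VS -> W = 0%VS \/ W = fullv].

Definition leonard_pair A B : Prop :=
  [/\ tridiagonal_pair A B,
      forall x, passmx.leigenvalue A x -> \dim (passmx.leigenspace A x) = 1%N
    & forall x, passmx.leigenvalue B x -> \dim (passmx.leigenspace B x) = 1%N].

(* E_i is the projection onto W_i along the sum of the other W_j. *)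
Definition eigenspace_projections (d : nat) (W : 'I_d.+1 -> {vspace V})
    (E : 'I_d.+1 -> 'End(V)) : Prop :=
  forall i, E i = daddv_pi (W i) (\sum_(j < d.+1 | j != i) W j)%VS.

(* The data (A; {E_i}; A^*; {E^*_i}); a trailing 's' stands for a star. *)
Record td_data (d : nat) := TDData {
  td_A : 'End(V);
  td_E : 'I_d.+1 -> 'End(V);
  td_As : 'End(V);
  td_Es : 'I_d.+1 -> 'End(V)
}.

Definition tridiagonal_system (d : nat) (Phi : td_data d) : Prop :=
  [/\ tridiagonal_pair (td_A Phi) (td_As Phi),
      exists2 W : 'I_d.+1 -> {vspace V},
        standard_ordering (td_A Phi) (td_As Phi) W
        & eigenspace_projections W (td_E Phi)
    & exists2 W : 'I_d.+1 -> {vspace V},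
        standard_ordering (td_As Phi) (td_A Phi) W
        & eigenspace_projections W (td_Es Phi)].

Definition leonard_system (d : nat) (Phi : td_data d) : Prop :=
  tridiagonal_system Phi /\ leonard_pair (td_A Phi) (td_As Phi).

Definition td_Down (d : nat) (Phi : td_data d) : td_data d :=
  TDData (td_A Phi) (fun i => td_E Phi (rev_ord i)) (td_As Phi) (td_Es Phi).

(* Scalar sequences are functions on nat; only the entries with index at most
   d (at least 1 for the first and second split sequences) are meaningful. *)
Definition eigenvalue_sequence (d : nat) (Phi : td_data d) (th : nat -> F) :=
  forall (i : 'I_d.+1) (v : V),
    v \in limg (td_E Phi i) -> td_A Phi v = th i *: v.

Definition dual_eigenvalue_sequence (d : nat) (Phi : td_data d)
    (ths : nat -> F) :=
  forall (i : 'I_d.+1) (v : V),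
    v \in limg (td_Es Phi i) -> td_As Phi v = ths i *: v.

(* (A^* - ths_1) ... (A^* - ths_i) (A - th_{i-1}) ... (A - th_0), where
   the rightmost factor acts first. *)
Definition split_operator (d : nat) (Phi : td_data d) (th ths : nat -> F)
    (i : nat) : 'End(V) :=
  ((\big[@comp_lfun F V V V / \1%VF]_(h <- iota 1 i)
      (td_As Phi - ths h *: \1%VF)) \o
   (\big[@comp_lfun F V V V / \1%VF]_(h <- rev (iota 0 i))
      (td_A Phi - th h *: \1%VF)))%VF.

(* The two eigenvalue sequences are determined by Phi up to index d, so the
   existential quantifier involves no choice. *)
Definition split_sequence (d : nat) (Phi : td_data d) (zeta : nat -> F) :=
  exists th ths : nat -> F,
    [/\ eigenvalue_sequence Phi th,
        dual_eigenvalue_sequence Phi ths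
      & forall (i : nat) (v : V), (i <= d)%N -> v \in limg (td_Es Phi ord0) ->
          split_operator Phi th ths i v = zeta i *: v].

Definition first_split_sequence (d : nat) (Phi : td_data d)
    (varphi : nat -> F) :=
  split_sequence Phi (fun i => \prod_(1 <= j < i.+1) varphi j).

Definition second_split_sequence (d : nat) (Phi : td_data d) (phi : nat -> F) :=
  first_split_sequence (td_Down Phi) phi.

(* For d <= 2 the base is an arbitrary nonzero scalar. *)
Definition is_base (d : nat) (Phi : td_data d) (beta : F) : Prop :=
  if (3 <= d)%N then
    exists th ths : nat -> F,
      [/\ eigenvalue_sequence Phi th,
          dual_eigenvalue_sequence Phi ths
        & forall i : nat, (2 <= i <= d.-1)%N ->
            (th (i - 2)%N - th i.+1) / (th i.-1 - th i) = beta + 1 /\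
            (ths (i - 2)%N - ths i.+1) / (ths i.-1 - ths i) = beta + 1]
  else beta != 0.

Definition type_IV (d : nat) (Phi : td_data d) : Prop :=
  is_base Phi 0 /\ 2%N \in [pchar F].

End TridiagonalPairs.

(* The normalized Drinfel'd polynomial in type IV; primes stand for stars. *)
Definition drinfeld_hat_IV (F : fieldType) (a b c a' b' c' : F)
    (zeta : nat -> F) : {poly F} :=
  let p1 := (a * b' + b * a' + (a + b + c) * (a' + b' + c'))%:P + 'X in
  let p2 := (c * c')%:P in
  let p3 := (a * b' + b * a' + (a + b) * (a' + b'))%:P + 'X in
  p1 * p2 * p3 + (zeta 1%N)%:P * p2 * p3 + (zeta 2%N)%:P * p3 + (zeta 3%N)%:P.

(* K, with the embedding j, is an algebraic closure of F (K being
   algebraically closed by its type). *)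
Definition algebraic_closure_of (F : fieldType) (K : closedFieldType)
    (j : {rmorphism F -> K}) : Prop :=
  forall x : K, algebraicOver j x.

(* s lists the roots of the nonzero polynomial p, with multiplicity. *)
Definition roots_are (K : fieldType) (p : {poly K}) (s : seq K) : Prop :=
  p != 0 /\ p = lead_coef p *: \prod_(x <- s) ('X - x%:P).

(* Main.v *)
Require Import Defs.
From mathcomp Require Import all_boot all_order all_algebra.
From mathcomp Require Import ring.

Set Implicit Arguments.
Unset Strict Implicit.
Unset Printing Implicit Defensive.

Import GRing.Theory.
Local Open Scope ring_scope.

(** The entries of zeta are products of the varphi_i, and varphi_1 and varphi_3
    are given in terms of psi, so the only fact about the Leonard system itself
    that is missing is zeta_2 = zeta_1 c c'.  The rest is algebra in
    characteristic 2.

    Why zeta_2 = zeta_1 c c'.  Let v span E*_0 V and put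
    u_k = (A - th_(k-1)) ... (A - th_0) v.  Let lower k be the sum of the first
    k eigenspaces of A*, and upper k the sum of the eigenspaces of A with index
    at least k.  Irreducibility forces lower k and upper k to meet in 0
    ([lower_cap_upper]): these intersections add up to an invariant proper
    subspace.  As u_k lies in lower (k+1) and in upper k, it follows that A* is
    upper bidiagonal in the u_k, with entries ths_k and f_k
    ([split_vector_dual]), and that zeta_i = f_1 ... f_i.  For d = 3 the vector
    x = (A - th_1)(A - th_2)(A - th_3) v is in the th_0-eigenspace of A.  Hence
    A* x lies in the sum of the first two eigenspaces, and
    (A - th_0)(A - th_1) A* x = 0.  The u_3-coordinate of this equation
    determines f_2 as soon as th_0 - th_2 = th_3 - th_1
    ([second_split_scalar]); in type IV the value is c c'.

    Why the roots are as claimed.  In characteristic 2, zeta_2 = zeta_1 c c'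
    makes the two middle terms of the Drinfel'd polynomial cancel, which leaves
    c c' (p_1 p_3 + varphi_1 varphi_3).  By the choice of psi,
    (c c')^2 varphi_1 varphi_3 is a product of four linear forms in psi, and its
    sum with (c c')^2 p_1 p_3 factors because these forms differ only by the
    shifts that occur in p_1 and p_3 ([char2_shifted_products]). *)

(** * Sums of eigenspaces in a standard ordering *)

Section StandardEigenlines.

Variables (F : fieldType) (V : vectType F) (A B : 'End(V)) (d : nat).
Variables (W : 'I_d.+1 -> {vspace V}) (th : nat -> F).

(** A standard ordering with one-dimensional eigenspaces, together with its
    eigenvalues.  The eigenvalues are indexed by nat so that th_(k+1) and
    th_(k-1) can be written without casts between ordinals. *)
Definition standard_eigenlines : Prop :=
  [/\ forall i, \dim (W i) = 1%N,
      forall i j : 'I_d.+1, th i = th j -> i = j,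
      forall (i : 'I_d.+1) (v : V), v \in W i <-> A v = th i *: v
    & forall i : 'I_d.+1,
        (B @: W i <= \sum_(j < d.+1 | (j <= i.+1)%N && (i <= j.+1)%N) W j)%VS].

Definition eigensum (P : pred nat) : {vspace V} :=
  (\sum_(j < d.+1 | P j) W j)%VS.

Lemma eigensumS (P Q : pred nat) :
  (forall j, (j <= d)%N -> P j -> Q j) -> (eigensum P <= eigensum Q)%VS.
Proof.
move=> PQ; apply/subv_sumP => j Pj; apply: (sumv_sup j) => //.
by apply: PQ => //; rewrite -ltnS.
Qed.

Lemma eigensum0 (P : pred nat) :
  (forall j, (j <= d)%N -> ~~ P j) -> eigensum P = 0%VS.
Proof.
move=> nP; rewrite /eigensum big_pred0 // => j; apply/negbTE/nP.
by rewrite -ltnS.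
Qed.

Hypothesis HW : standard_eigenlines.

(** The sums are indexed by arbitrary predicates so that this lemma serves the
    spaces upper k and lower k, and the independence of the eigenspaces, at
    once. *)
Lemma eigensum_shift (P : pred nat) (k : nat) (v : V) :
  v \in eigensum P ->
  A v - th k *: v \in eigensum [pred j | P j && (j != k)].
Proof.
case: HW => _ _ AW _ /memv_sumP[vs Pvs ->].
rewrite linear_sum /= scaler_sumr -sumrB; apply: memv_suml => j Pj.
have /AW -> := Pvs j Pj; rewrite -scalerBl.
have [<-|jk] := eqVneq (j : nat) k; first by rewrite subrr scale0r mem0v.
apply: memvZ; apply: subvP (Pvs j Pj); apply: (sumv_sup j) => //=.
by rewrite Pj.
Qed.

Lemma eigensum_step (P Q : pred nat) (v : V) :
    (forall i j, P i -> (j <= i.+1)%N -> (i <= j.+1)%N -> Q j) ->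
  v \in eigensum P -> B v \in eigensum Q.
Proof.
case: HW => _ _ _ BW PQ /memv_sumP[vs Pvs ->].
rewrite linear_sum /=; apply: memv_suml => i Pi.
apply: subvP (memv_img B (Pvs i Pi)); apply: subv_trans (BW i) _.
apply/subv_sumP => j /andP[ji ij]; apply: (sumv_sup j) => //.
exact: PQ Pi ji ij.
Qed.

(** Eigenspaces are independent: applying A - th_k only rescales v by a nonzero
    factor when k differs from i, so the summands can be removed from the sum
    one after the other. *)
Lemma eigenline_cap_eigensum (i : 'I_d.+1) (P : pred nat) (v : V) :
  ~~ P i -> v \in W i -> v \in eigensum P -> v = 0.
Proof.
move=> nPi Wv Pv; case: (HW) => _ thI AW _.
have Pk k : v \in eigensum [pred j | P j && (k <= j)%N].
  elim: k => [|k IHk].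
    by apply: subvP Pv; apply: eigensumS => j _ /= ->.
  have [ik|ik] := eqVneq (i : nat) k.
    apply: subvP IHk; apply: eigensumS => j _ /= /andP[Pj].
    rewrite Pj leq_eqVlt => /orP[/eqP kj|//].
    by move: nPi; rewrite ik kj Pj.
  have [kd|dk] := leqP k d; last first.
    rewrite (_ : v = 0) ?mem0v //; apply/eqP; rewrite -memv0.
    rewrite -(@eigensum0 [pred j | P j && (k <= j)%N]) // => j jd /=.
    by rewrite negb_and -ltnNge (leq_ltn_trans jd dk) orbT.
  have:= eigensum_shift k IHk; rewrite (AW i v).1 // -scalerBl.
  rewrite rpredZeq; case/orP => [|Pv'].
    rewrite subr_eq0 => /eqP /(thI i (Ordinal (kd : (k < d.+1)%N))) e.
    by rewrite e eqxx in ik.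
  apply: subvP Pv'; apply: eigensumS => j _ /= /andP[/andP[-> kj] jk].
  by rewrite ltn_neqAle eq_sym jk.
apply/eqP; rewrite -memv0 -(@eigensum0 [pred j | P j && (d < j)%N]) //.
by move=> j jd /=; rewrite negb_and -leqNgt jd orbT.
Qed.

Lemma eigenline_neq0 i : W i != 0%VS.
Proof. by case: HW => /(_ i) W1 _ _ _; rewrite -dimv_eq0 W1. Qed.

Lemma eigensum_proper (P : pred nat) (i : 'I_d.+1) :
  ~~ P i -> eigensum P <> fullv.
Proof.
move=> nPi full; have := eigenline_neq0 i; rewrite -vpick0 => /eqP; apply.
by apply: eigenline_cap_eigensum nPi (memv_pick _) _; rewrite full memvf.
Qed.

Lemma eigenline_combination i (x y : V) :
  x \in W i -> y \in W i -> y != 0 -> exists c, x = c *: y.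
Proof.
case: HW => /(_ i) W1 _ _ _ Wx Wy y0.
have /eqP yW : <[y]>%VS == W i by rewrite eqEdim -memvE Wy dim_vline y0 W1.
by apply/vlineP; rewrite yW.
Qed.

End StandardEigenlines.

(** * Split vectors *)

Definition irreducible_pair (F : fieldType) (V : vectType F) (A B : 'End(V)) :=
  forall W : {vspace V},
    (A @: W <= W)%VS -> (B @: W <= W)%VS -> W = 0%VS \/ W = fullv.

Lemma invariantP (F : fieldType) (V : vectType F) (A : 'End(V))
    (U : {vspace V}) :
  (forall v, v \in U -> A v \in U) -> (A @: U <= U)%VS.
Proof. by move=> AU; apply/subvP => _ /memv_imgP[v Uv ->]; apply: AU. Qed.

(** The tridiagonal relation makes the sum of the eigenspaces of A invariant
    under B as well, and it is nonzero. *)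
Lemma eigensum_full (F : fieldType) (V : vectType F) (A B : 'End(V)) (d : nat)
    (W : 'I_d.+1 -> {vspace V}) (th : nat -> F) :
  standard_eigenlines A B W th -> irreducible_pair A B ->
  eigensum W predT = fullv.
Proof.
move=> HW irr; case: (irr (eigensum W predT)) => //.
- apply: invariantP => v Wv; rewrite -[A v](subrK (th 0%N *: v)).
  apply: memvD; last exact: memvZ.
  by apply: subvP (eigensum_shift HW 0 Wv); apply: eigensumS.
- by apply: invariantP => v; apply: (eigensum_step HW).
move=> W0; have := eigenline_neq0 HW ord0; rewrite -subv0 => /negP[].
by rewrite -W0 /eigensum; apply: (sumv_sup ord0).
Qed.

Section SplitVectors.

Variables (F : fieldType) (V : vectType F) (A B : 'End(V)) (d : nat).
Variables (W Ws : 'I_d.+1 -> {vspace V}) (th ths : nat -> F).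
Hypotheses (HW : standard_eigenlines A B W th).
Hypotheses (HWs : standard_eigenlines B A Ws ths).
Hypothesis irr : irreducible_pair A B.

Local Notation upper k := (eigensum W [pred j | (k <= j)%N]).
Local Notation lower k := (eigensum Ws [pred j | (j < k)%N]).

Lemma lower_le k l : (k <= l)%N -> (lower k <= lower l)%VS.
Proof. by move=> kl; apply: eigensumS => j _ /= /leq_trans; apply. Qed.

Lemma upper_le k l : (l <= k)%N -> (upper k <= upper l)%VS.
Proof. by move=> lk; apply: eigensumS => j _ /=; apply: leq_trans. Qed.

Lemma upper_raise k v : v \in upper k -> A v - th k *: v \in upper k.+1.
Proof.
move=> Uv; apply: subvP (eigensum_shift HW k Uv).
by apply: eigensumS => j _ /= /andP[kj jk]; rewrite ltn_neqAle eq_sym jk.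
Qed.

Lemma upper_step k v : v \in upper k.+1 -> B v \in upper k.
Proof. by apply: (eigensum_step HW) => i j /= ki _ /(leq_trans ki). Qed.

Lemma lower_drop k v : v \in lower k.+1 -> B v - ths k *: v \in lower k.
Proof.
move=> Lv; apply: subvP (eigensum_shift HWs k Lv).
by apply: eigensumS => j _ /= /andP[jk ne]; rewrite ltn_neqAle ne.
Qed.

Lemma lower_step k v : v \in lower k -> A v \in lower k.+1.
Proof.
by apply: (eigensum_step HWs) => i j /= ik ji _; apply: leq_ltn_trans ji _.
Qed.

(** Let N_k be the intersection of lower k and upper k.  Then A - th_k maps N_k
    into N_(k+1), and B - ths_(k-1) maps N_k into N_(k-1), so the sum of all N_k
    is invariant.  It is contained in upper 1, hence not the whole space, and
    therefore zero. *)
Lemma lower_cap_upper k v : v \in lower k -> v \in upper k -> v = 0.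
Proof.
pose N l := (lower l :&: upper l)%VS.
pose S := (\sum_(l < d.+2) N l)%VS.
have NS l : (N l <= S)%VS.
  have [ld|dl] := ltnP l d.+2; first exact: (sumv_sup (Ordinal ld)).
  rewrite (_ : N l = 0%VS) ?sub0v //; apply/eqP; rewrite -subv0.
  apply: subv_trans (capvSr _ _) _; rewrite eigensum0 // => j jd /=.
  by rewrite -ltnNge; apply: leq_ltn_trans jd (ltnW dl).
have stable (f : 'End(V)) :
    (forall l v, v \in N l -> f v \in S) -> (f @: S <= S)%VS.
  move=> fN; apply: invariantP => w /memv_sumP[ws Nws ->].
  by rewrite linear_sum /=; apply: memv_suml => l _; apply: fN (Nws l isT).
have S0 : S = 0%VS.
  case: (irr (W := S)) => //.
  - apply: stable => l w Nw; rewrite -[A w](subrK (th l *: w)).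
    apply: memvD; last by apply: memvZ; apply: subvP (NS l) _ Nw.
    move: Nw; rewrite memv_cap => /andP[Lw Uw]; apply: (subvP (NS l.+1)).
    rewrite memv_cap upper_raise // andbT memvB ?lower_step //.
    by apply: memvZ; apply: subvP Lw; apply: lower_le.
  - apply: stable => -[|l] w Nw.
      move: Nw; rewrite memv_cap eigensum0 // memv0 => /andP[/eqP-> _].
      by rewrite linear0 mem0v.
    rewrite -[B w](subrK (ths l *: w)).
    apply: memvD; last by apply: memvZ; apply: subvP (NS l.+1) _ Nw.
    move: Nw; rewrite memv_cap => /andP[Lw Uw]; apply: (subvP (NS l)).
    rewrite memv_cap lower_drop //= memvB ?upper_step //.
    by apply: memvZ; apply: subvP Uw; apply: upper_le.
  move=> full.
  case: (eigensum_proper HW (P := [pred j | 0 < j]%N) (i := ord0)) => //.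
  apply/eqP; rewrite eqEsubv subvf /= -full.
  apply/subv_sumP => -[[|l] ltl] _ /=.
    rewrite /N eigensum0 // cap0v; exact: sub0v.
  by apply: subv_trans (capvSr _ _) _; apply: upper_le.
move=> Lv Uv; apply/eqP; rewrite -memv0 -S0; apply: (subvP (NS k)).
by rewrite memv_cap Lv.
Qed.

Variable v : V.
Hypotheses (Wsv : v \in Ws ord0) (v0 : v != 0).

Fixpoint split_vector k :=
  if k is l.+1 then A (split_vector l) - th l *: split_vector l else v.

Lemma split_vector_upper k : split_vector k \in upper k.
Proof.
elim: k => [|k IHk]; last exact: upper_raise.
rewrite (_ : eigensum W _ = fullv) ?memvf //.
by rewrite -(eigensum_full HW irr).
Qed.

Lemma split_vector_lower k : split_vector k \in lower k.+1.
Proof.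
elim: k => [|k IHk] /=; first by apply: subvP Wsv; apply: (sumv_sup ord0).
rewrite memvB ?lower_step //.
by apply: memvZ; apply: subvP IHk; apply: lower_le.
Qed.

Lemma split_vector_ge k : (d < k)%N -> split_vector k = 0.
Proof.
move=> dk; apply/eqP; rewrite -memv0 -(@eigensum0 _ _ _ W [pred j | k <= j]%N).
  exact: split_vector_upper.
by move=> j jd /=; rewrite -ltnNge (leq_ltn_trans jd).
Qed.

Lemma split_vector0_dual : B v = ths 0%N *: v.
Proof. by case: HWs => _ _ BW _; apply: (BW ord0 v).1. Qed.

(** Modulo upper (k+1), the space upper k is a line, and lower (k+1) meets
    upper (k+1) only in 0. *)
Lemma split_line k x : (k <= d)%N ->
    x \in lower k.+1 -> x \in upper k -> split_vector k != 0 ->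
  exists c, x = c *: split_vector k.
Proof.
move=> kd Lx Ux u0; set u := split_vector k in u0 *.
have [Lu Uu] : u \in lower k.+1 /\ u \in upper k.
  by split; [apply: split_vector_lower | apply: split_vector_upper].
pose i := Ordinal (kd : (k < d.+1)%N).
have dec w : w \in upper k ->
    exists2 p, p \in W i & w - p \in upper k.+1.
  rewrite /eigensum (bigD1 i) //= => /memv_addP[p Wp [q Wq ->]].
  exists p => //; rewrite addrC addKr; apply: subvP Wq.
  apply/subv_sumP => j /andP[kj ji]; apply: (sumv_sup j) => //=.
  by rewrite ltn_neqAle kj andbT eq_sym.
have [p Wp Uxp] := dec _ Ux; have [q Wq Uuq] := dec _ Uu.
have q0 : q != 0.
  apply: contraNneq u0 => q0; apply/eqP; apply: (lower_cap_upper Lu).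
  by rewrite -[u]subr0 -q0.
have [c pq] := eigenline_combination HW Wp Wq q0; exists c.
apply/eqP; rewrite -subr_eq0; apply/eqP.
apply: (@lower_cap_upper k.+1); first by rewrite memvB ?memvZ.
rewrite (_ : _ - _ = (x - p) - c *: (u - q)).
  by rewrite memvB ?memvZ.
by rewrite scalerBr -pq opprB addrA subrK.
Qed.

(** (B - ths_(k+1)) u_(k+1) lies in both lower (k+1) and upper k. *)
Lemma split_vector_dual k : (k <= d)%N ->
  exists f, B (split_vector k.+1) =
            ths k.+1 *: split_vector k.+1 + f *: split_vector k.
Proof.
move=> kd; have [u0|u0] := eqVneq (split_vector k) 0.
  by exists 0; rewrite /= u0 !(linear0, scaler0, subrr, addr0).
have [||f fE] := @split_line k (B (split_vector k.+1) -
                              ths k.+1 *: split_vector k.+1) kd _ _ u0.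
- exact/lower_drop/split_vector_lower.
- rewrite memvB ?upper_step ?split_vector_upper // memvZ //.
  by apply: subvP (split_vector_upper k.+1); apply: upper_le.
by exists f; rewrite -fE addrC subrK.
Qed.

(** Once a split vector vanishes, all later ones do, and the earlier ones span
    an invariant subspace.  It contains u_0 = v, so irreducibility makes it the
    whole space; but if u_k = 0 with k <= d, it lies in the proper subspace
    lower k. *)
Lemma split_vector_neq0 k : (k <= d)%N -> split_vector k != 0.
Proof.
move=> kd; apply/eqP => uk0.
have u0 l : (k <= l)%N -> split_vector l = 0.
  move=> /subnKC <-; elim: (l - k)%N => [|m IHm]; first by rewrite addn0.
  by rewrite addnS /= IHm linear0 scaler0 subrr.
pose T := (\sum_(l < k) <[split_vector l]>)%VS.
have Tu l : split_vector l \in T.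
  have [lk|/u0->] := ltnP l k; last exact: mem0v.
  by rewrite memvE; apply: (sumv_sup (Ordinal lk)).
have stable (f : 'End(V)) :
    (forall l, (l < k)%N -> f (split_vector l) \in T) -> (f @: T <= T)%VS.
  move=> fT; apply: invariantP => w /memv_sumP[ws Tws ->].
  rewrite linear_sum /=; apply: memv_suml => l _.
  by have /vlineP[c ->] := Tws l isT; rewrite linearZ memvZ ?fT.
case: (irr (W := T)).
- apply: stable => l _; rewrite -[A _](subrK (th l *: split_vector l)).
  by rewrite memvD ?memvZ ?Tu // (Tu l.+1).
- apply: stable => -[|l] lk.
    by rewrite /= split_vector0_dual memvZ ?(Tu 0%N).
  have [|f ->] := @split_vector_dual l; last by rewrite memvD ?memvZ ?Tu.
  by apply: leq_trans kd; rewrite ltnW // ltnW.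
- by move=> T0; have := Tu 0%N; rewrite T0 memv0; apply/negP.
move=> full; case: (@eigensum_proper _ _ B A d Ws ths HWs [pred j | j < k]%N
                      (Ordinal (kd : (k < d.+1)%N))); first by rewrite /= ltnn.
apply/eqP; rewrite eqEsubv subvf /= -full.
apply/subv_sumP => l _; rewrite -memvE.
by apply: subvP (split_vector_lower l); apply: lower_le.
Qed.

End SplitVectors.
Arguments split_vector : simpl never.

(** The vector x of the proof is (A - th_1)(A - th_2)(A - th_3) v, written in
    the split vectors; it satisfies A x = th_0 x because u_4 = 0.  The
    tridiagonal relation puts B x into the sum of the first two eigenspaces of
    A, so (A - th_0)(A - th_1) B x = 0.  In the u_3-coordinate of this equation
    f_1 does not occur, and f_3 has the coefficient
    th_3 - th_1 + th_2 - th_0, which is zero by the assumption on the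
    eigenvalues. *)
Lemma second_split_scalar (F : fieldType) (V : vectType F) (A B : 'End(V))
    (W Ws : 'I_4 -> {vspace V}) (th ths : nat -> F) (v : V) (f : F) :
    standard_eigenlines A B W th -> standard_eigenlines B A Ws ths ->
    irreducible_pair A B -> v \in Ws ord0 -> v != 0 ->
    th 0%N - th 2%N = th 3%N - th 1%N ->
    B (split_vector A th v 2) =
      ths 2%N *: split_vector A th v 2 + f *: split_vector A th v 1 ->
  f = (th 3%N - th 1%N) * (ths 3%N - ths 1%N).
Proof.
move=> HW HWs irr Wsv v0 sym Bu2; pose u := split_vector A th v.
have uE k : A (u k) = th k *: u k + u k.+1 by rewrite /u /= [RHS]addrC subrK.
have u4 : u 4%N = 0 by apply: (split_vector_ge HW irr).
have [f1 Bu1] : exists f1, B (u 1%N) = ths 1%N *: u 1%N + f1 *: u 0%N.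
  exact: (split_vector_dual HW HWs irr).
have [f3 Bu3] : exists f3, B (u 3%N) = ths 3%N *: u 3%N + f3 *: u 2%N.
  exact: (split_vector_dual HW HWs irr).
have Bu0 : B (u 0%N) = ths 0%N *: u 0%N by apply: (split_vector0_dual HWs).
pose comb c0 c1 c2 c3 : V :=
  c0 *: u 0%N + c1 *: u 1%N + c2 *: u 2%N + c3 *: u 3%N.
(* Only the last coordinate matters: lower 3 contains u_0, u_1 and u_2, and
   meets the line of u_3 in 0. *)
have comb_eq0 c0 c1 c2 c3 : comb c0 c1 c2 c3 = 0 -> c3 = 0.
  move=> c0E.
  have : c3 *: u 3%N = 0.
    apply: (lower_cap_upper HW HWs irr (k := 3)).
      rewrite (_ : c3 *: _ = - (c0 *: u 0%N + c1 *: u 1%N + c2 *: u 2%N)).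
        rewrite memvN !memvD // memvZ //.
        - by apply: subvP (split_vector_lower th HWs Wsv 0); apply: lower_le.
        - by apply: subvP (split_vector_lower th HWs Wsv 1); apply: lower_le.
        - exact: (split_vector_lower th HWs Wsv 2).
      by apply/eqP; rewrite -addr_eq0 addrC -c0E.
    by rewrite memvZ ?(split_vector_upper HW irr v 3).
  move/eqP; rewrite scaler_eq0 => /orP[/eqP//|].
  by rewrite (negPf (split_vector_neq0 HW HWs irr Wsv v0 (leqnn 3))).
(* Without its body, u is atomic for the rewriting of linear combinations. *)
rewrite -/u in Bu2; clearbody u.
have combD a0 a1 a2 a3 b0 b1 b2 b3 : comb a0 a1 a2 a3 + comb b0 b1 b2 b3 =
    comb (a0 + b0) (a1 + b1) (a2 + b2) (a3 + b3).
  by rewrite /comb !scalerDl; do 3!(rewrite addrACA; congr (_ + _)).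
have combZ t c0 c1 c2 c3 :
    t *: comb c0 c1 c2 c3 = comb (t * c0) (t * c1) (t * c2) (t * c3).
  by rewrite /comb !scalerDr !scalerA.
have [e0 e1 e2 e3] : [/\ u 0%N = comb 1 0 0 0, u 1%N = comb 0 1 0 0,
    u 2%N = comb 0 0 1 0 & u 3%N = comb 0 0 0 1].
  by split; rewrite /comb !scale0r !scale1r ?addr0 ?add0r.
have combA c0 c1 c2 c3 t : A (comb c0 c1 c2 c3) - t *: comb c0 c1 c2 c3 =
    comb ((th 0%N - t) * c0) ((th 1%N - t) * c1 + c0)
         ((th 2%N - t) * c2 + c1) ((th 3%N - t) * c3 + c2).
  rewrite -scaleNr combZ {1}/comb !linearD !linearZ /= !uE u4 addr0.
  rewrite e0 e1 e2 e3 !(combZ, combD).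
  by congr (comb _ _ _ _); ring.
have combB c0 c1 c2 c3 : B (comb c0 c1 c2 c3) =
    comb (ths 0%N * c0 + f1 * c1) (ths 1%N * c1 + f * c2)
         (ths 2%N * c2 + f3 * c3) (ths 3%N * c3).
  rewrite {1}/comb !linearD !linearZ /= Bu0 Bu1 Bu2 Bu3.
  rewrite e0 e1 e2 e3 !(combZ, combD).
  by congr (comb _ _ _ _); ring.
pose t2 := th 0%N - th 2%N; pose t3 := th 0%N - th 3%N.
pose x := comb ((th 0%N - th 1%N) * t2 * t3) (t2 * t3) t3 1.
have Wx : x \in W ord0.
  case: (HW) => _ _ AW _; apply/AW/eqP; rewrite -subr_eq0 combA.
  rewrite (_ : comb _ _ _ _ = comb 0 0 0 0).
    by rewrite /comb !scale0r !addr0.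
  by congr (comb _ _ _ _); rewrite /t2 /t3; ring.
have Bx : B x \in eigensum W [pred j | j < 2]%N.
  apply: (eigensum_step HW (P := pred1 0%N)) => [i j /= /eqP-> //|].
  by apply: subvP Wx; apply: (sumv_sup ord0).
have t30 : t3 != 0.
  case: (HW) => _ thI _ _; rewrite subr_eq0; apply/eqP.
  by move=> /(thI ord0 ord_max)/(congr1 val).
have y0 (y := B x) (z := A y - th 1%N *: y) : A z - th 0%N *: z = 0.
  pose none := [pred j | (j < 2) && (j != 1) && (j != 0)]%N.
  apply/eqP; rewrite -memv0 -(@eigensum0 _ _ _ W none).
    by do 2!apply: (eigensum_shift HW).
  by move=> [|[|j]].
move: y0; rewrite /x combB !combA => /comb_eq0 E.
apply: (mulIf t30); apply/eqP; rewrite -subr_eq0.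
have th2E : th 2%N = th 0%N - (th 3%N - th 1%N) by rewrite -sym; ring.
rewrite -E /t2 /t3 th2E; apply/eqP; ring.
Qed.

(** * Eigenvalues and split sequences of a Leonard system *)

Lemma lfun_shiftE (F : fieldType) (V : vectType F) (A : 'End(V)) x v :
  (A - x *: \1%VF) v = A v - x *: v.
Proof. by rewrite add_lfunE opp_lfunE scale_lfunE id_lfunE. Qed.

Lemma memv_leigenspace (F : fieldType) (V : vectType F) (A : 'End(V)) x v :
  v \in passmx.leigenspace A x <-> A v = x *: v.
Proof.
rewrite /passmx.leigenspace memv_ker lfun_shiftE subr_eq0.
by split=> /eqP.
Qed.

Lemma scalar_unique (F : fieldType) (V : vectType F) (v : V) (x y : F) :
  v != 0 -> x *: v = y *: v -> x = y.
Proof.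
move=> v0 /eqP; rewrite -subr_eq0 -scalerBl scaler_eq0 (negPf v0) orbF.
by rewrite subr_eq0 => /eqP.
Qed.

Lemma eigenvalue_unique (F : fieldType) (V : vectType F) (A B : 'End(V))
    (d : nat) (W : 'I_d.+1 -> {vspace V}) (th th' : nat -> F) (i : 'I_d.+1) :
    standard_eigenlines A B W th ->
    (forall v, v \in W i -> A v = th' i *: v) ->
  th' i = th i.
Proof.
move=> HW Ath'; have := eigenline_neq0 HW i; rewrite -vpick0 => v0.
have Wv := memv_pick (W i); apply: (scalar_unique v0); rewrite -Ath' //.
by case: HW => _ _ /(_ i (vpick (W i)))[/(_ Wv)].
Qed.

(** Independence of the eigenspaces makes E_i the identity on W_i.  So the image
    of E_i contains eigenvectors, and these identify th with the eigenvalues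
    that come with the ordering. *)
Lemma standard_ordering_eigenlines (F : fieldType) (V : vectType F)
    (A B : 'End(V)) (d : nat) (W : 'I_d.+1 -> {vspace V})
    (E : 'I_d.+1 -> 'End(V)) (th : nat -> F) :
    standard_ordering A B W -> eigenspace_projections W E ->
    (forall x, passmx.leigenvalue A x ->
       \dim (passmx.leigenspace A x) = 1%N) ->
    (forall (i : 'I_d.+1) v, v \in limg (E i) -> A v = th i *: v) ->
  standard_eigenlines A B W th /\ forall i, limg (E i) = W i.
Proof.
move=> [[mu [muI muP WE]] BW] EW dim1 Eth.
have HW : standard_eigenlines A B W (fun n => mu (inord n)).
  split=> [i|i j|i v|//]; last by rewrite inord_val WE; apply: memv_leigenspace.
    by rewrite WE dim1 //; apply/muP; exists i.
  by rewrite !inord_val => /muI.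
have imE i : limg (E i) = W i.
  apply/eqP; rewrite eqEsubv EW; apply/andP; split.
    by apply/subvP => _ /memv_imgP[v _ ->]; apply: memv_pi.
  apply/subvP => v Wv; rewrite -(@daddv_pi_id _ _ (W i)
      (\sum_(j < d.+1 | j != i) W j) v) ?memv_img ?memvf //.
  apply/eqP; rewrite -subv0; apply/subvP => x; rewrite memv_cap memv0.
  case/andP => Wx Sx; apply/eqP.
  have {}Sx : x \in eigensum W [pred n : nat | n != i :> nat].
    by apply: subvP Sx; apply/subv_sumP => l li; apply: (sumv_sup l).
  by apply: (eigenline_cap_eigensum HW _ Wx Sx); rewrite /= eqxx.
have muE (i : 'I_d.+1) : mu i = th i.
  rewrite (eigenvalue_unique (th' := th) (i := i) HW) ?inord_val // => v.
  by rewrite -imE; apply: Eth.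
split=> //; case: HW => W1 _ AW _; split=> // [i j|i v].
  by rewrite -!muE => /muI.
by rewrite -muE -{1}(inord_val i); have := AW i v; rewrite inord_val.
Qed.

Lemma leonard_system_eigenlines (F : fieldType) (V : vectType F) (d : nat)
    (Phi : td_data V d) (th ths : nat -> F) :
    leonard_system Phi -> eigenvalue_sequence Phi th ->
    dual_eigenvalue_sequence Phi ths ->
  exists W Ws,
    [/\ standard_eigenlines (td_A Phi) (td_As Phi) W th,
        standard_eigenlines (td_As Phi) (td_A Phi) Ws ths,
        irreducible_pair (td_A Phi) (td_As Phi)
      & (forall i, limg (td_E Phi i) = W i) /\
        (forall i, limg (td_Es Phi i) = Ws i)].
Proof.
move=> [[[_ _ _ irr] [W WO EW] [Ws WsO EsWs]] [_ dimA dimAs]] Hth Hths.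
have [HW imE] := standard_ordering_eigenlines WO EW dimA Hth.
have [HWs imEs] := standard_ordering_eigenlines WsO EsWs dimAs Hths.
by exists W, Ws.
Qed.

Section LeonardSystem.

Variables (F : fieldType) (V : vectType F) (d : nat) (Phi : td_data V d).
Hypothesis HPhi : leonard_system Phi.
Variables th ths : nat -> F.
Hypotheses (Hth : eigenvalue_sequence Phi th).
Hypotheses (Hths : dual_eigenvalue_sequence Phi ths).

Lemma eigenvalue_sequence_inj i k :
  (i <= d)%N -> (k <= d)%N -> th i = th k -> i = k.
Proof.
have [W [Ws [[_ thI _ _] _ _ _]]] := leonard_system_eigenlines HPhi Hth Hths.
move=> id kd thik.
pose i' := Ordinal (id : (i < d.+1)%N); pose k' := Ordinal (kd : (k < d.+1)%N).
exact: (congr1 val (thI i' k' thik)).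
Qed.

Lemma dual_eigenvalue_sequence_inj i k :
  (i <= d)%N -> (k <= d)%N -> ths i = ths k -> i = k.
Proof.
have [W [Ws [_ [_ thI _ _] _ _]]] := leonard_system_eigenlines HPhi Hth Hths.
move=> id kd thik.
pose i' := Ordinal (id : (i < d.+1)%N); pose k' := Ordinal (kd : (k < d.+1)%N).
exact: (congr1 val (thI i' k' thik)).
Qed.

Lemma eigenvalue_sequence_unique th' i :
  eigenvalue_sequence Phi th' -> (i <= d)%N -> th' i = th i.
Proof.
have [W [Ws [HW _ _ [imE _]]]] := leonard_system_eigenlines HPhi Hth Hths.
move=> Hth' id; pose i' := Ordinal (id : (i < d.+1)%N).
apply: (eigenvalue_unique (i := i') HW).
by move=> v; rewrite -imE; apply: Hth'.
Qed.

Lemma dual_eigenvalue_sequence_unique ths' i :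
  dual_eigenvalue_sequence Phi ths' -> (i <= d)%N -> ths' i = ths i.
Proof.
have [W [Ws [_ HWs _ [_ imEs]]]] := leonard_system_eigenlines HPhi Hth Hths.
move=> Hth' id; pose i' := Ordinal (id : (i < d.+1)%N).
apply: (eigenvalue_unique (i := i') HWs).
by move=> v; rewrite -imEs; apply: Hth'.
Qed.

Lemma split_sequenceE zeta i v :
    split_sequence Phi zeta -> (i <= d)%N -> v \in limg (td_Es Phi ord0) ->
  split_operator Phi th ths i v = zeta i *: v.
Proof.
move=> [th' [ths' [Hth' Hths' zE]]] id Ev; rewrite -zE //.
rewrite /split_operator; congr (fun_of_lfun (_ \o _)%VF v).
  apply: eq_big_seq => h; rewrite mem_iota add1n ltnS => /andP[_ hi].
  by rewrite (dual_eigenvalue_sequence_unique Hths') // (leq_trans hi).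
apply: eq_big_seq => h; rewrite mem_rev mem_iota add0n /= => hi.
by rewrite (eigenvalue_sequence_unique Hth') // (leq_trans (ltnW hi)).
Qed.

Lemma split_sequence_unique zeta zeta' i :
    split_sequence Phi zeta -> split_sequence Phi zeta' -> (i <= d)%N ->
  zeta i = zeta' i.
Proof.
have [W [Ws [_ HWs _ [_ imEs]]]] := leonard_system_eigenlines HPhi Hth Hths.
move=> Hz Hz' id; have := eigenline_neq0 HWs ord0; rewrite -vpick0 => v0.
have Ev : vpick (Ws ord0) \in limg (td_Es Phi ord0) by rewrite imEs memv_pick.
apply: (scalar_unique v0).
by rewrite -(split_sequenceE Hz id Ev) -(split_sequenceE Hz' id Ev).
Qed.

Lemma split_operator_rightE i v :
  (\big[@comp_lfun F V V V / \1%VF]_(h <- rev (iota 0 i))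
      (td_A Phi - th h *: \1%VF))%VF v = split_vector (td_A Phi) th v i.
Proof.
elim: i => [|i IHi]; first by rewrite big_nil id_lfunE.
by rewrite -addn1 iotaD rev_cat big_cons addn1 comp_lfunE lfun_shiftE IHi.
Qed.

End LeonardSystem.

(** Reading zeta_1 = f_1 and zeta_2 = f_1 f_2 off the split vectors. *)
Lemma split_sequence_ratio (F : fieldType) (V : vectType F)
    (Phi : td_data V 3%N) (th ths zeta : nat -> F) :
    leonard_system Phi -> eigenvalue_sequence Phi th ->
    dual_eigenvalue_sequence Phi ths -> split_sequence Phi zeta ->
    th 0%N - th 2%N = th 3%N - th 1%N ->
  zeta 2%N = zeta 1%N * ((th 3%N - th 1%N) * (ths 3%N - ths 1%N)).
Proof.
move=> HPhi Hth Hths Hz sym.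
have [W [Ws [HW HWs irr [_ imEs]]]] := leonard_system_eigenlines HPhi Hth Hths.
have := eigenline_neq0 HWs ord0; rewrite -vpick0; set v := vpick _ => v0.
have Wv : v \in Ws ord0 by apply: memv_pick.
have Ev : v \in limg (td_Es Phi ord0) by rewrite imEs.
have [f1 Bu1] := split_vector_dual HW HWs irr Wv (isT : (0 <= 3)%N).
have [f2 Bu2] := split_vector_dual HW HWs irr Wv (isT : (1 <= 3)%N).
rewrite -(second_split_scalar HW HWs irr Wv v0 sym Bu2).
have z1 : zeta 1%N = f1.
  apply: (scalar_unique v0).
  rewrite -(split_sequenceE HPhi Hth Hths Hz _ Ev) //.
  rewrite /split_operator comp_lfunE split_operator_rightE big_cons big_nil.
  by rewrite comp_lfunE id_lfunE lfun_shiftE Bu1 addrC addKr.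
apply: (scalar_unique v0); rewrite -(split_sequenceE HPhi Hth Hths Hz _ Ev) //.
rewrite /split_operator comp_lfunE split_operator_rightE !big_cons big_nil.
rewrite !comp_lfunE id_lfunE !lfun_shiftE Bu2 [_ + f2 *: _]addrC addrK.
rewrite linearZ /= scalerA [_ * f2]mulrC -[(f2 * _) *: _]scalerA -scalerBr Bu1.
rewrite [_ + f1 *: _]addrC addrK.
by rewrite z1 scalerA [f2 * _]mulrC.
Qed.

(** If d >= 4, then the first two base equations with base 0 give
    th_0 = th_1 - th_2 + th_3 = th_4; and base 0 is excluded for d <= 2. *)
Lemma type_IV_diameter (F : fieldType) (V : vectType F) (d : nat)
    (Phi : td_data V d) :
  leonard_system Phi -> type_IV Phi -> d = 3%N.
Proof.
move=> HPhi []; rewrite /is_base; case: ifP => [d3|_]; last by rewrite eqxx.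
move=> [th [ths [Hth Hths base]]] _.
have ratio1 (x y : F) : x / y = 0 + 1 -> x = y.
  rewrite add0r; have [->|y0] := eqVneq y 0; last exact: divr1_eq.
  by rewrite invr0 mulr0 => /eqP; rewrite eq_sym oner_eq0.
apply/eqP; rewrite eqn_leq d3 andbT leqNgt; apply/negP => d4.
have [|/ratio1 e2 _] := base 2%N; first by case: (d) d3 => [|[|[]]].
have [|/ratio1 e3 _] := base 3%N; first by case: (d) d4 => [|[|[|[]]]].
suff /(eigenvalue_sequence_inj HPhi Hth Hths (leq0n d) d4) :
  th 0%N = th 4%N by [].
rewrite -[th 0%N](subrK (th 3%N)) -[th 4%N](subKr (th 1%N)).
rewrite -[th 0%N - _]/(th (2 - 2)%N - _) e2.
rewrite -[th 1%N - th 4%N]/(th (3 - 2)%N - _) e3 /=.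
ring.
Qed.

(** * The roots of the Drinfel'd polynomial *)

(** Reduces an identity in characteristic 2 to a ring identity with an explicit
    even error term. *)
Lemma char2_eq (R : pzRingType) (x y z : R) :
  2%:R = 0 :> R -> x = y + 2%:R * z -> x = y.
Proof. by move=> -> ->; rewrite mul0r addr0. Qed.

(** The coefficients of t agree because y (y + P + Q) = (y + P)(y + Q) - P Q,
    and likewise with y + k for y.  The constant terms agree because, with
    G = (y + P)(y + Q) and H = (y + P + k)(y + Q + k), the element
    G + H - P Q + (P + k)(Q + k) is even. *)
Lemma char2_shifted_products (R : comPzRingType) (t y P Q k : R) :
    2%:R = 0 :> R ->
  (t + (P + k) * (Q + k)) * (t + P * Q) +
    (y + Q) * (y + P + k) * ((y + P) * (y + Q + k)) =
  (t + y * (y + P + Q)) * (t + (y + k) * (y + k + P + Q)).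
Proof.
move=> two0; apply/esym.
pose z := y * (y + P + Q + k).
by apply: (char2_eq (z := t * (z - P * Q) - P * Q * (z + (P + k) * (Q + k)))
  two0); rewrite /z; ring.
Qed.

(** In characteristic 2 the linear forms in psi are y, y + P, y + Q and
    y + P + Q, each with or without the shift by k, where
    y = k psi + a c' + b' c, P = (a + b) c' and Q = (a' + b') c.  With X for the
    indeterminate, k times the first factor of the Drinfel'd polynomial is
    k t + (P + k)(Q + k), and k times the third is k t + P Q. *)
Lemma drinfeld_hat_IV_factor (R : comPzRingType)
    (a b c a' b' c' psi X z1 f3 : R) (k := c * c') (t := a * b' + b * a' + X) :
    2%:R = 0 :> R ->
    k * z1 = (a * c' + a' * c + k * psi) * (b * c' + b' * c + k + k * psi) ->
    k * f3 = (b * c' + b' * c + k * psi) * (a * c' + a' * c + k + k * psi) ->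
  k * k * ((t + (a + b + c) * (a' + b' + c')) * (t + (a + b) * (a' + b')) +
           z1 * f3) =
  (k * t + (k * psi + (a * c' + b' * c)) * (k * psi + (a' * c + b * c'))) *
  (k * t + (k * psi + (a * c' + b' * c + k)) *
           (k * psi + (a' * c + b * c' + k))).
Proof.
move=> two0 z1E f3E; pose y := k * psi + (a * c' + b' * c).
pose P := (a + b) * c'; pose Q := (a' + b') * c.
have eq2 (z u v : R) : u = v + 2%:R * z -> u = v by exact: (char2_eq two0).
have yPQ : k * psi + (a' * c + b * c') = y + P + Q.
  by apply/esym/(eq2 (a * c' + b' * c)); rewrite /y /P /Q; ring.
have yQ : a * c' + a' * c + k * psi = y + Q.
  by apply/esym/(eq2 (b' * c)); rewrite /y /Q; ring.
have yP : b * c' + b' * c + k * psi = y + P.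
  by apply/esym/(eq2 (a * c')); rewrite /y /P; ring.
transitivity ((k * t + (P + k) * (Q + k)) * (k * t + P * Q) +
              (k * z1) * (k * f3)); first by rewrite /P /Q /k; ring.
rewrite z1E f3E ![_ + k + k * psi]addrAC yP yQ -!/y.
rewrite (char2_shifted_products _ _ _ _ _ two0) yPQ.
have -> : k * psi + (a' * c + b * c' + k) = y + k + P + Q.
  by rewrite addrA yPQ; ring.
by rewrite /y [k * psi + (_ + k)]addrA.
Qed.

Lemma roots_are_factor (K : fieldType) (p : {poly K}) (k : K) (s : seq K) :
  k != 0 -> p = k *: \prod_(x <- s) ('X - x%:P) -> roots_are p s.
Proof.
move=> k0 pE; have lead : lead_coef p = k.
  by rewrite pE lead_coefZ (monicP (monic_prod_XsubC _ _ _)) mulr1.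
by split; rewrite ?lead // -lead_coef_eq0 lead.
Qed.

Lemma drinfeld_hat_IV_map (F K : fieldType) (j : {rmorphism F -> K})
    (a b c a' b' c' : F) (zeta : nat -> F) :
  map_poly j (drinfeld_hat_IV a b c a' b' c' zeta) =
  drinfeld_hat_IV (j a) (j b) (j c) (j a') (j b') (j c') (j \o zeta).
Proof.
rewrite /drinfeld_hat_IV /=.
by rewrite !(rmorphD, rmorphM) /= !map_polyX !map_polyC.
Qed.

Lemma drinfeld_hat_IV_roots (K : fieldType) (a b c a' b' c' psi f3 : K)
    (zeta : nat -> K) (k := c * c') :
    2%:R = 0 :> K -> c != 0 -> c' != 0 ->
    zeta 2%N = zeta 1%N * k -> zeta 3%N = zeta 2%N * f3 ->
    k * zeta 1%N =
      (a * c' + a' * c + k * psi) * (b * c' + b' * c + k + k * psi) ->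
    k * f3 = (b * c' + b' * c + k * psi) * (a * c' + a' * c + k + k * psi) ->
  roots_are (drinfeld_hat_IV a b c a' b' c' zeta)
    [:: a * b' + b * a' + (k * psi + (a * c' + b' * c)) *
          (k * psi + (a' * c + b * c')) * (c^-1 * c'^-1);
        a * b' + b * a' + (k * psi + (a * c' + b' * c + k)) *
          (k * psi + (a' * c + b * c' + k)) * (c^-1 * c'^-1)].
Proof.
move=> two0 c0 c'0 z2 z3 z1E f3E.
have k0 : k != 0 by rewrite mulf_neq0.
have kV : c^-1 * c'^-1 = k^-1 by rewrite /k invfM.
rewrite kV; apply: (roots_are_factor k0); rewrite big_cons big_seq1.
have two0P : 2%:R = 0 :> {poly K} by rewrite -polyC_natr two0.
have kP0 : k%:P * k%:P != 0 by rewrite mulf_neq0 ?polyC_eq0.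
pose r (N : K) := a * b' + b * a' + N / k.
have lin N : k%:P * ('X - (r N)%:P) =
    k%:P * ((a * b' + b * a')%:P + 'X) + N%:P.
  apply/esym; apply: (char2_eq (z := k%:P * (a * b' + b * a')%:P + N%:P) two0P).
  have kk : k%:P * (N / k)%:P = N%:P by rewrite -polyCM mulrCA divff ?mulr1.
  by rewrite (polyCD _ (N / k)) mulrBr [in RHS](mulrDr k%:P) kk; ring.
have clear_denominators N M :
    k%:P * k%:P * (k *: (('X - (r N)%:P) * ('X - (r M)%:P))) =
    k%:P * ((k%:P * ((a * b' + b * a')%:P + 'X) + N%:P) *
            (k%:P * ((a * b' + b * a')%:P + 'X) + M%:P)).
  by rewrite -!lin -mul_polyC; ring.
apply: (mulfI kP0); rewrite clear_denominators.
have /(congr1 polyC) := z1E; have /(congr1 polyC) := f3E.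
rewrite /k !(polyCD, polyCM) => f3EP z1EP.
rewrite -(drinfeld_hat_IV_factor _ two0P z1EP f3EP).
(* The even term consists of the two equal middle terms zeta_1 p_2 p_3 and
   zeta_2 p_3. *)
pose p3 := a%:P * b'%:P + b%:P * a'%:P + (a%:P + b%:P) * (a'%:P + b'%:P) + 'X.
pose kP := c%:P * c'%:P.
apply: (char2_eq (z := kP * kP * ((zeta 1%N)%:P * kP * p3)) two0P).
by rewrite /drinfeld_hat_IV z3 z2 /p3 /kP /k !(polyCD, polyCM); ring.
Qed.

Theorem theorem12p11
  (F : fieldType) (K : closedFieldType) (j : {rmorphism F -> K})
  (HK : algebraic_closure_of j)
  (V : vectType F) (HV : (0 < \dim {:V})%N)
  (d : nat) (Phi : td_data V d)
  (HPhi : leonard_system Phi) (HIV : type_IV Phi)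
  (th ths : nat -> F)
  (Hth : eigenvalue_sequence Phi th)
  (Hths : dual_eigenvalue_sequence Phi ths)
  (a b c a' b' c' : F)
  (Hth0 : th 0%N = a) (Hth1 : th 1%N = b + c)
  (Hth2 : th 2%N = a + c) (Hth3 : th 3%N = b)
  (Hths0 : ths 0%N = a') (Hths1 : ths 1%N = b' + c')
  (Hths2 : ths 2%N = a' + c') (Hths3 : ths 3%N = b')
  (zeta varphi phi : nat -> F)
  (Hzeta : split_sequence Phi zeta)
  (Hvarphi : first_split_sequence Phi varphi)
  (Hphi : second_split_sequence Phi phi)
  (psi : K)
  (Hvarphi1 : j (c * c' * varphi 1%N) =
     (j (a * c' + a' * c) + j (c * c') * psi) *
     (j (b * c' + b' * c + c * c') + j (c * c') * psi))
  (Hvarphi3 : j (c * c' * varphi 3%N) =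
     (j (b * c' + b' * c) + j (c * c') * psi) *
     (j (a * c' + a' * c + c * c') + j (c * c') * psi))
  (Hphi1 : j (c * c' * phi 1%N) =
     (j (b * c' + a' * c) + j (c * c') * psi) *
     (j (a * c' + b' * c + c * c') + j (c * c') * psi))
  (Hphi3 : j (c * c' * phi 3%N) =
     (j (a * c' + b' * c) + j (c * c') * psi) *
     (j (b * c' + a' * c + c * c') + j (c * c') * psi)) :
  roots_are (map_poly j (drinfeld_hat_IV a b c a' b' c' zeta))
    [:: j (a * b' + b * a') +
        (j (c * c') * psi + j (a * c' + b' * c)) *
        (j (c * c') * psi + j (a' * c + b * c')) * j (c^-1 * c'^-1);
        j (a * b' + b * a') +
        (j (c * c') * psi + j (a * c' + b' * c + c * c')) *
        (j (c * c') * psi + j (a' * c + b * c' + c * c')) *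
        j (c^-1 * c'^-1)].
Proof.
have d3 := type_IV_diameter HPhi HIV; subst d.
have two0 : 2%:R = 0 :> K by rewrite -(rmorph_nat j) (pcharf0 HIV.2) rmorph0.
have le23 : (2 <= 3)%N by [].
have c0 : c != 0.
  apply/eqP => c0; suff e : th 0%N = th 2%N.
    by have := eigenvalue_sequence_inj HPhi Hth Hths (leq0n 3) le23 e.
  by rewrite Hth0 Hth2 c0 addr0.
have c'0 : c' != 0.
  apply/eqP => c'0; suff e : ths 0%N = ths 2%N.
    by have := dual_eigenvalue_sequence_inj HPhi Hth Hths (leq0n 3) le23 e.
  by rewrite Hths0 Hths2 c'0 addr0.
have zetaE i : (i <= 3)%N -> zeta i = \prod_(1 <= l < i.+1) varphi l.
  exact: (split_sequence_unique HPhi Hth Hths Hzeta Hvarphi).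
have z1 : zeta 1%N = varphi 1%N by rewrite zetaE // big_nat1.
have z3 : zeta 3%N = zeta 2%N * varphi 3%N.
  by rewrite !zetaE // [LHS]big_nat_recr.
have z2 : zeta 2%N = zeta 1%N * (c * c').
  rewrite (split_sequence_ratio HPhi Hth Hths Hzeta).
    by rewrite Hth3 Hth1 Hths3 Hths1 !opprD !addrA !subrr !add0r mulrNN.
  by rewrite Hth0 Hth1 Hth2 Hth3; ring.
rewrite drinfeld_hat_IV_map; move: Hvarphi1 Hvarphi3; rewrite -z1.
rewrite !(rmorphD, rmorphM, fmorphV) /= => ? ?.
apply: (drinfeld_hat_IV_roots (f3 := j (varphi 3%N))) => //=.
- by rewrite fmorph_eq0.
- by rewrite fmorph_eq0.
- by rewrite z2 !rmorphM.
- by rewrite z3 rmorphM.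
Qed.
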